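(* Fix $\beta>0$ and assume $\mathbf{R}=\mathbf{C}=\mathbf{D}$. Let $\mathbf{F}=(F_i)_{i=1}^n$ be a sequence of past-parameterized PEFs, with $F_i$ a PEF with power $\beta$ for $\mathcal{C}_i$ and $C_i|Z_i$. Let $T_0=1$ and $T_i=\prod_{1\le j\le i}F_j$. Then for every $\epsilon\in(0,1]$, both $$\mathcal{U}_\beta(\mathbf{RZ},1-\epsilon)=(T_n\epsilon)^{-1/\beta}\quad\text{and}\quad \mathcal{U}^*_\beta(\mathbf{RZ},1-\epsilon)=\Bigl(\max_{0\le i\le n}(T_i\epsilon)\Bigr)^{-1/\beta}$$ are $\epsilon$-$\mathrm{UPE}(\mathbf{C}{:}\mathbf{C}|\mathbf{Z};\mathcal{H}(\mathcal{C}))$.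
   Context: All random variables (RVs) have finite value spaces. $\mathbf{C}=(C_i)_{i=1}^n$, $\mathbf{Z}=(Z_i)_{i=1}^n$, etc. are sequences of trial RVs; $\mathbf{C}_{\le i}=(C_j)_{j=1}^i$. Expectations are sums over values of positive probability only, and conditions on conditional distributions are only required for conditioning values of positive probability. An external RV $E$ is suppressed: every definition and conclusion is to be read conditionally on $E=e$ for an arbitrary fixed value $e$. PEF: let $\beta>0$ and let $\mathcal{C}$ be a set of distributions of $CZ$, and $D$ a function of $C$. A probability estimation factor (PEF) with power $\beta$ for $\mathcal{C}$ and $D|Z$ is a non-negative function $F=F(CZ)$ such that $\mathbb{E}_\nu(F(CZ)\,\nu(D|Z)^\beta)\le1$ for all $\nu\in\mathcal{C}$. Here $D=C$. Standard model $\mathcal{H}(\mathcal{C})$: for each $i$ and each past value $\mathbf{r}_{\le i}\mathbf{z}_{\le i}$ one is given a set $\mathcal{C}_{i+1}=\mathcal{C}_{i+1|\mathbf{r}_{\le i}\mathbf{z}_{\le i}}$ of distributions of $C_{i+1}Z_{i+1}$ (dependence on the past left implicit). $\mathcal{H}(\mathcal{C})$ is the set of distributions $\mu$ of $\mathbf{RZ}$ such that (i) for all $i$ and $\mathbf{r}_{\le i}\mathbf{z}_{\le i}$, $\mu[C_{i+1}Z_{i+1}|\mathbf{r}_{\le i}\mathbf{z}_{\le i}]\in\mathcal{C}_{i+1|\mathbf{r}_{\le i}\mathbf{z}_{\le i}}$, and (ii) $Z_{i+1}$ is independent of $\mathbf{R}_{\le i}$ conditionally on $\mathbf{Z}_{\le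 i}$. Past-parameterized: $F_{i+1}$ is a function of $C_{i+1}Z_{i+1}$ that may depend on $\mathbf{R}_{\le i}\mathbf{Z}_{\le i}$ as parameters, and for each value of these parameters it is a PEF for the corresponding $\mathcal{C}_{i+1|\mathbf{r}_{\le i}\mathbf{z}_{\le i}}$. UPE: a function $G$ of $\mathbf{CZ}$ is an $\epsilon$-$\mathrm{UPE}(\mathbf{C}{:}\mathbf{C}|\mathbf{Z};\mathcal{H})$ (level-$\epsilon$ uniform probability estimator) if for all $\mu\in\mathcal{H}$, $\mu\bigl(G(\mathbf{CZ})\ge\mu(\mathbf{C}|\mathbf{Z})\bigr)\ge1-\epsilon$, where $\mu(\mathbf{C}|\mathbf{Z})$ is the RV whose value at $\mathbf{cz}$ is $\mu(\mathbf{C}=\mathbf{c}|\mathbf{Z}=\mathbf{z})$. Estimators are allowed the value $+\infty$, with $0^{-1/\beta}=+\infty$. *)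

(* Defs.v *)
From mathcomp Require Import all_boot all_order all_algebra.
From mathcomp Require Import boolp classical_sets reals constructive_ereal exp.
Set Implicit Arguments.
Unset Strict Implicit.
Unset Printing Implicit Defensive.
Import Order.TTheory GRing.Theory Num.Theory.
Local Open Scope ring_scope.

Record fdist (R : realType) (T : finType) := FDist {
  pmf :> {ffun T -> R};
  fdistP : [forall x, 0 <= pmf x] && (\sum_x pmf x == 1) }.

Section FiniteProbability.
Variables (R : realType) (T : finType) (mu : fdist R T).

Definition Pr (A : pred T) : R := \sum_(w | A w) mu w.

(* Equal to 0 when Pr B = 0; every use below is restricted to Pr B > 0. *)
Definition condPr (A B : pred T) : R := Pr (predI A B) / Pr B.

Definition expect (f : T -> R) : R := \sum_(w | 0 < mu w) mu w * f w.

(* mu(X|Y) as a random variable: its value at w is mu(X = X w | Y = Y w). *)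
Definition cprob (U V : eqType) (X : T -> U) (Y : T -> V) : T -> R :=
  fun w => condPr [pred v | X v == X w] [pred v | Y v == Y w].

Definition cond_indep (U V W : finType)
    (X : T -> U) (Y : T -> V) (S : T -> W) : Prop :=
  forall s, 0 < Pr [pred w | S w == s] ->
  forall x y,
    condPr [pred w | (X w == x) && (Y w == y)] [pred w | S w == s] =
    condPr [pred w | X w == x] [pred w | S w == s] *
    condPr [pred w | Y w == y] [pred w | S w == s].

Definition cond_pmf (U : finType) (X : T -> U) (A : pred T) : {ffun U -> R} :=
  [ffun x => condPr [pred w | X w == x] A].

Lemma cond_pmfP (U : finType) (X : T -> U) (A : pred T) : 0 < Pr A ->
  [forall x, 0 <= cond_pmf X A x] && (\sum_x cond_pmf X A x == 1).
Proof.
have mu_ge0 w : 0 <= mu w by case/andP: (fdistP mu) => /forallP/(_ w).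
move=> A_gt0; apply/andP; split.
  by apply/forallP => x; rewrite ffunE divr_ge0 // sumr_ge0.
under eq_bigr do rewrite ffunE.
rewrite -mulr_suml.
suff -> : \sum_x Pr (predI [pred w | X w == x] A) = Pr A.
  by rewrite divff // gt_eqF.
rewrite /Pr [RHS](partition_big X predT) //=.
by apply: eq_bigr => x _; apply: eq_bigl => w /=; rewrite andbC.
Qed.

(* The conditional distribution mu[X | A] of X, given 0 < Pr A. *)
Definition cond_law (U : finType) (X : T -> U) (A : pred T)
  (A_gt0 : 0 < Pr A) : fdist R U := FDist (cond_pmfP X A_gt0).

End FiniteProbability.

(* Probability estimation factor with power beta for the set M of
   distributions of CZ and for D|Z, where D is a function of C. *)
Definition is_PEF (R : realType) (C Z DT : finType) (beta : R)
    (M : set (fdist R (C * Z)%type)) (D : C -> DT) (F : C * Z -> R) : Prop :=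
  (forall cz, 0 <= F cz) /\
  (forall nu, M nu ->
    expect nu (fun cz =>
      F cz * (cprob nu (fun w => D w.1) (fun w => w.2) cz) `^ beta) <= 1).

Section Trials.
(* Trials are indexed by 'I_n, starting from 0, and the finite value space may
   change from trial to trial. *)
Variables (n : nat).

Definition traj (X : 'I_n -> finType) : finType :=
  {dffun forall i : 'I_n, X i}.

(* Values of the trials strictly before trial i. *)
Definition past (X : 'I_n -> finType) (i : 'I_n) : finType :=
  {dffun forall j : 'I_i, X (widen_ord (ltnW (ltn_ord i)) j)}.

Definition past_of (X : 'I_n -> finType) (x : traj X) (i : 'I_n) : past X i :=
  [ffun j : 'I_i => x (widen_ord (ltnW (ltn_ord i)) j)].

Variables (R : realType) (C Z : 'I_n -> finType).

(* For each trial and each value of the past, a set of distributions. *)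
Definition trial_models :=
  forall i : 'I_n, past C i -> past Z i -> set (fdist R (C i * Z i)%type).

(* For each trial and each value of the past, a function of that trial. *)
Definition trial_factors :=
  forall i : 'I_n, past C i -> past Z i -> C i * Z i -> R.

Definition is_past_param_PEF (beta : R) (M : trial_models)
    (F : trial_factors) : Prop :=
  forall (i : 'I_n) (c : past C i) (z : past Z i),
    is_PEF beta (M i c z) (@id (C i)) (F i c z).

(* The standard model H(M), in the case R = C. *)
Definition std_model (M : trial_models) :
    set (fdist R (traj C * traj Z)%type) :=
  fun mu =>
    (forall (i : 'I_n) (c : past C i) (z : past Z i)
       (pos : 0 < Pr mu [pred w : traj C * traj Z | (past_of w.1 i == c) &&
                                                (past_of w.2 i == z)]),
       M i c z (cond_law (fun w : traj C * traj Z => (w.1 i, w.2 i)) pos)) /\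
    (forall i : 'I_n,
       cond_indep mu (fun w : traj C * traj Z => w.2 i)
                     (fun w : traj C * traj Z => past_of w.1 i)
                     (fun w : traj C * traj Z => past_of w.2 i)).

(* Level-eps uniform probability estimator UPE(C:C|Z; H). *)
Definition is_UPE (eps : R) (H : set (fdist R (traj C * traj Z)%type))
    (G : traj C * traj Z -> \bar R) : Prop :=
  forall mu, H mu ->
    1 - eps <= Pr mu [pred w | ((cprob mu fst snd w)%:E <= G w)%E].

(* T_k, the product of the factors of the first k trials. *)
Definition Tprod (F : trial_factors) (k : nat) (w : traj C * traj Z) : R :=
  \prod_(j < n | (j < k)%N)
     F j (past_of w.1 j) (past_of w.2 j) (w.1 j, w.2 j).

End Trials.

(* x^(-1/beta) for x >= 0, with 0^(-1/beta) = +oo (whereas powR gives 0). *)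
Definition neg_root (R : realType) (beta x : R) : \bar R :=
  if x == 0 then +oo%E else (x `^ (- beta^-1))%:E.

Definition U_est (R : realType) (n : nat) (C Z : 'I_n -> finType) (beta eps : R)
    (F : trial_factors R C Z) (w : traj C * traj Z) : \bar R :=
  neg_root beta (Tprod F n w * eps).

(* Seeding the maximum with its i = 0 term makes it the maximum over
   0 <= i <= n. *)
Definition Ustar_est (R : realType) (n : nat) (C Z : 'I_n -> finType)
    (beta eps : R) (F : trial_factors R C Z) (w : traj C * traj Z) : \bar R :=
  neg_root beta
    (\big[Num.max/Tprod F 0%N w * eps]_(i < n.+1) (Tprod F i w * eps)).

(* Main.v *)
Require Import Defs.
From mathcomp Require Import all_boot all_order all_algebra.
From mathcomp Require Import boolp classical_sets reals constructive_ereal exp.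
Set Implicit Arguments.
Unset Strict Implicit.
Unset Printing Implicit Defensive.
Import Order.TTheory GRing.Theory Num.Theory.
Local Open Scope ring_scope.

(** Let [p_i = mu(C_i | Z_i, C_{<i}, Z_{<i})].  Since [Z_i] is independent of
    [C_{<i}] given [Z_{<i}], the probability [mu(C | Z)] telescopes into the
    product of the [p_i].  The PEF inequality says that each factor
    [F_i * p_i ^ beta] has conditional expectation at most 1 given the past, so
    the partial products [Q_k = T_k * (\prod_(j < k) p_j) ^ beta] form a
    nonnegative supermartingale started at 1, and by Ville's maximal inequality
    [max_k Q_k > 1 / eps] has probability at most [eps].  Off this event,
    [mu(C | Z) <= \prod_(j < k) p_j] gives [T_k * eps * mu(C | Z) ^ beta <= 1]
    for all [k], which is what both estimators require. *)

Lemma prod_ord_recr (R : realType) (n : nat) (f : 'I_n -> R) (i : 'I_n) :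
  \prod_(j < n | (j < i.+1)%N) f j = \prod_(j < n | (j < i)%N) f j * f i.
Proof.
rewrite (bigD1 i) //= mulrC; congr (_ * _); apply: eq_bigl => j.
by rewrite ltnS ltn_neqAle andbC.
Qed.

(** The step receives its index as an element of ['I_n], so that families indexed by trials can be
    evaluated there. *)
Lemma ord_nat_ind (n : nat) (P : nat -> Prop) :
  P 0%N -> (forall i : 'I_n, P i -> P i.+1) -> forall k, (k <= n)%N -> P k.
Proof.
move=> P0 PS; elim=> // k IHk lt_kn.
by apply: (PS (Ordinal lt_kn)); apply/IHk/ltnW.
Qed.

(** * Ville's maximal inequality for weights on a finite set *)

Section Ville.
Variables (R : realType) (T : finType) (n : nat) (mu : T -> R).
Variables (S : 'I_n -> finType) (h : forall i, T -> S i) (X : 'I_n -> T -> R).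
Arguments h : clear implicits.
Hypothesis mu_ge0 : forall w, 0 <= mu w.
Hypothesis X_ge0 : forall i w, 0 <= X i w.
(** [h j] records what is known before trial [j]; its level sets are the atoms of that
    information. *)
Hypothesis X_adapted : forall (i j : 'I_n) w w',
  (i < j)%N -> h j w = h j w' -> X i w = X i w'.
(** The conditional mean bound, multiplied out so that atoms of weight zero cause no division. *)
Hypothesis X_super : forall i w0,
  \sum_(w | h i w == h i w0) mu w * X i w <= \sum_(w | h i w == h i w0) mu w.
Variable lam : R.

Let Q k w := \prod_(j < n | (j < k)%N) X j w.
Let crossed k w := [exists l : 'I_n.+1, (l <= k)%N && (lam < Q l w)].
(** Whether factor [j] is frozen at 1 depends on factors before [j] only, so [h j] already decides
    it. *)
Let Y (j : 'I_n) w := if crossed j w then 1 else X j w.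
(* Q stopped at the first time it exceeds lam. *)
Let V k w := \prod_(j < n | (j < k)%N) Y j w.

Let Q_adapted (j : 'I_n) k w w' :
  (k <= j)%N -> h j w = h j w' -> Q k w = Q k w'.
Proof.
move=> le_kj eq_h; apply: eq_bigr => i lt_ik.
by apply: X_adapted eq_h; apply: leq_trans le_kj.
Qed.

Let crossed_adapted (j : 'I_n) k w w' :
  (k <= j)%N -> h j w = h j w' -> crossed k w = crossed k w'.
Proof.
move=> le_kj eq_h; apply: eq_existsb => l.
have [le_lk|//] := leqP l k.
by rewrite (Q_adapted (leq_trans le_lk le_kj) eq_h).
Qed.

Let V_adapted (j : 'I_n) w w' : h j w = h j w' -> V j w = V j w'.
Proof.
move=> eq_h; apply: eq_bigr => i lt_ij.
by rewrite /Y (crossed_adapted (ltnW lt_ij) eq_h) (X_adapted lt_ij eq_h).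
Qed.

Let V_ge0 k w : 0 <= V k w.
Proof. by apply: prodr_ge0 => j _; rewrite /Y; case: ifP. Qed.

(** On an atom of [h i] both [V i] and [crossed i] are constant, so [V i] factors out and what
    remains is the factor 1 or [X i]; [X_super] bounds the latter. *)
Let V_expect k : (k <= n)%N -> \sum_w mu w * V k w <= \sum_w mu w.
Proof.
move: k; apply: ord_nat_ind => [|i IHi].
  by apply: ler_sum => w _; rewrite /V big_pred0 // mulr1.
apply: le_trans IHi.
rewrite (partition_big (h i) predT) //= [leRHS](partition_big (h i) predT) //=.
apply: ler_sum => s _.
(* A representative of the atom; values that [h i] does not take give empty sums. *)
have [w0 /eqP <-|no_w] := pickP (fun w => h i w == s); last by rewrite !big_pred0.
have -> : \sum_(w | h i w == h i w0) mu w * V i.+1 w =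
    V i w0 * \sum_(w | h i w == h i w0) mu w * (if crossed i w0 then 1 else X i w).
  rewrite mulr_sumr; apply: eq_bigr => w /eqP eq_h.
  rewrite /V prod_ord_recr -/(V i w) (V_adapted eq_h) /Y.
  by rewrite (crossed_adapted (leqnn i) eq_h) mulrCA.
have -> : \sum_(w | h i w == h i w0) mu w * V i w =
    V i w0 * \sum_(w | h i w == h i w0) mu w.
  by rewrite mulr_sumr; apply: eq_bigr => w /eqP/V_adapted->; rewrite mulrC.
apply: ler_wpM2l => //; case: (crossed i w0); last exact: X_super.
by apply: ler_sum => w _; rewrite mulr1.
Qed.

(** [Q] may fall back below [lam] after crossing, whereas [V] keeps the value it had at the first
    crossing. *)
Let V_crossed k w : (k <= n)%N ->
  (crossed k w -> lam < V k w) /\ (~~ crossed k w -> V k w = Q k w).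
Proof.
move: k; apply: ord_nat_ind => [|i [IHcr IHncr]].
  by rewrite /V /Q !big_pred0 //; split=> // /existsP[l /andP[]];
     rewrite leqn0 => /eqP->; rewrite /Q big_pred0.
have VS : V i.+1 w = V i w * Y i w by apply: prod_ord_recr.
have QS : Q i.+1 w = Q i w * X i w by apply: (prod_ord_recr (fun j => X j w)).
rewrite VS QS /Y.
case: (boolP (crossed i w)) => [cr_i|ncr_i].
  rewrite mulr1; split=> [_|]; first exact: IHcr.
  case/existsP: cr_i => l /andP[le_li lt_Q] /existsP[].
  by exists l; rewrite leqW.
(* With no crossing up to [i], a new one can only occur at [i.+1], where [V] and [Q] still
   coincide. *)
rewrite (IHncr ncr_i); split=> // /existsP[l /andP[]].
rewrite leq_eqVlt ltnS => /orP[/eqP->|le_li lt_Q]; first by rewrite QS.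
by case/existsP: ncr_i; exists l; rewrite le_li.
Qed.

(** Markov's inequality for [V n], which exceeds [lam] wherever some [Q k] does. *)
Lemma Ville_inequality :
  lam * \sum_(w | [exists k : 'I_n.+1, lam < \prod_(j < n | (j < k)%N) X j w])
    mu w <= \sum_w mu w.
Proof.
apply: le_trans (V_expect (leqnn n)); rewrite mulr_sumr.
rewrite [leRHS](bigID (crossed n)) /= ler_wpDr //.
  by apply: sumr_ge0 => w _; rewrite mulr_ge0.
have cross_n w :
    [exists k : 'I_n.+1, lam < \prod_(j < n | (j < k)%N) X j w] = crossed n w.
  by apply: eq_existsb => k; rewrite -ltnS ltn_ord.
rewrite (eq_bigl _ _ cross_n); apply: ler_sum => w cr_w.
by rewrite mulrC ler_wpM2l //; apply/ltW/(V_crossed w (leqnn n)).1.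
Qed.

End Ville.

(** * Agreement of trajectories on an initial segment *)

Section Agreement.
Variables (n : nat) (X : 'I_n -> finType).

(** Comparing whole trajectories avoids the dependent type [past], and also covers [k = n], for
    which no [past] exists. *)
Definition agree k (x y : traj X) := [forall j : 'I_n, (j < k)%N ==> (x j == y j)].

Lemma agreeP k (x y : traj X) :
  reflect (forall j : 'I_n, (j < k)%N -> x j = y j) (agree k x y).
Proof.
apply: (iffP forallP) => [agr j lt_jk | agr j].
  by apply/eqP; apply: (implyP (agr j)).
by apply/implyP => lt_jk; rewrite agr.
Qed.

Lemma past_of_eq (i : 'I_n) (x y : traj X) :
  (past_of x i == past_of y i) = agree i x y.
Proof.
apply/eqP/agreeP => [eq_xy j lt_ji | agr].
  have -> : j = widen_ord (ltnW (ltn_ord i)) (Ordinal lt_ji) by apply: val_inj.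
  by move/ffunP: eq_xy => /(_ (Ordinal lt_ji)); rewrite !ffunE.
by apply/ffunP => j; rewrite !ffunE; apply: agr => /=.
Qed.

Lemma agree0 (x y : traj X) : agree 0 x y.
Proof. exact/agreeP. Qed.

Lemma agree_all (x y : traj X) : agree n x y = (x == y).
Proof.
apply/agreeP/eqP => [agr|-> //].
by apply/ffunP => j; apply: agr.
Qed.

Lemma agreeS (i : 'I_n) (x y : traj X) :
  agree i.+1 x y = agree i x y && (x i == y i).
Proof.
apply/agreeP/andP => [agr|[/agreeP agr /eqP eq_i] j].
  by split; [apply/agreeP => j lt_ji|rewrite agr]; rewrite ?agr // leqW.
by rewrite ltnS leq_eqVlt => /orP[/eqP/val_inj->|/agr].
Qed.

Lemma agree_sub k l (x y : traj X) : (k <= l)%N -> agree l x y -> agree k x y.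
Proof.
by move=> le_kl /agreeP agr; apply/agreeP => j lt_jk; rewrite agr ?(leq_trans lt_jk).
Qed.

Lemma agree_right k (x y z : traj X) : agree k x y -> agree k z x = agree k z y.
Proof.
move=> /agreeP xy; apply/agreeP/agreeP => agr j lt_jk; first by rewrite agr ?xy.
by rewrite agr // xy.
Qed.

End Agreement.

(** * Elementary probability on a finite space *)

Section Probability.
Variables (R : realType) (T : finType) (mu : fdist R T).

Lemma fdist_ge0 w : 0 <= mu w.
Proof. by case/andP: (fdistP mu) => /forallP. Qed.

Lemma fdist_sum1 : \sum_w mu w = 1.
Proof. by case/andP: (fdistP mu) => _ /eqP. Qed.

Lemma Pr_ge0 (A : pred T) : 0 <= Pr mu A.
Proof. by apply: sumr_ge0 => w _; apply: fdist_ge0. Qed.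

Lemma eq_Pr (A B : pred T) : A =1 B -> Pr mu A = Pr mu B.
Proof. exact: eq_bigl. Qed.

Lemma Pr_le (A B : pred T) :
  (forall w, 0 < mu w -> A w -> B w) -> Pr mu A <= Pr mu B.
Proof.
move=> sAB; rewrite /Pr big_mkcond [leRHS]big_mkcond; apply: ler_sum => w _.
case: ifP => Aw; last by case: ifP => // _; apply: fdist_ge0.
case: ifPn => // nBw; rewrite leNgt; apply: contra nBw => mu_w; exact: sAB.
Qed.

Lemma Pr_gt0 (A : pred T) w : A w -> 0 < mu w -> 0 < Pr mu A.
Proof.
move=> Aw mu_w; rewrite /Pr (bigD1 w) //=.
by apply: ltr_wpDr => //; apply: sumr_ge0 => v _; apply: fdist_ge0.
Qed.

Lemma Pr_predC (A : pred T) : Pr mu A = 1 - Pr mu (predC A).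
Proof. by have := fdist_sum1; rewrite (bigID A) /= => <-; rewrite addrK. Qed.

Lemma expectE (f : T -> R) : expect mu f = \sum_w mu w * f w.
Proof.
rewrite /expect [RHS](bigID (fun w => 0 < mu w)) /= [X in _ + X]big1 ?addr0 //.
move=> w; rewrite lt_def fdist_ge0 andbT negbK => /eqP->; exact: mul0r.
Qed.

End Probability.

Lemma cprob_gt0 (R : realType) (T : finType) (U V : eqType) (mu : fdist R T)
    (X : T -> U) (Y : T -> V) w :
  0 < mu w -> 0 < cprob mu X Y w.
Proof. by move=> mu_w; rewrite divr_gt0 ?(Pr_gt0 (w := w)) //= !eqxx. Qed.

(** * Computing under a conditional law *)

Section ConditionalLaw.
Variables (R : realType) (T U : finType) (mu : fdist R T) (f : T -> U).
Variables (A : pred T) (A_gt0 : 0 < Pr mu A).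

Lemma sum_cond_law (B : pred U) (g : U -> R) :
  \sum_(x | B x) cond_law f A_gt0 x * g x =
  (\sum_(w | B (f w) && A w) mu w * g (f w)) / Pr mu A.
Proof.
rewrite (partition_big f B) /= => [|w /andP[]//]; rewrite mulr_suml.
apply: eq_bigr => x Bx; rewrite ffunE /condPr /Pr mulrAC; congr (_ / _).
rewrite mulr_suml; apply: eq_big => [w|w /andP[/eqP-> _]] //=.
by rewrite andbC; case: eqP => [->|]; rewrite ?Bx ?andbF ?andbT.
Qed.

Lemma expect_cond_law (g : U -> R) :
  expect (cond_law f A_gt0) g = (\sum_(w | A w) mu w * g (f w)) / Pr mu A.
Proof. by rewrite expectE sum_cond_law. Qed.

Lemma condPr_cond_law (B D : pred U) :
  condPr (cond_law f A_gt0) B D =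
  Pr mu [pred w | (B (f w) && D (f w)) && A w] / Pr mu [pred w | D (f w) && A w].
Proof.
have Pr_law (E : pred U) :
    Pr (cond_law f A_gt0) E = Pr mu [pred w | E (f w) && A w] / Pr mu A.
  rewrite /Pr (eq_bigr (fun x => cond_law f A_gt0 x * 1)) => [|x _];
    last by rewrite mulr1.
  by rewrite sum_cond_law; under eq_bigr do rewrite mulr1.
by rewrite /condPr !Pr_law /= -mulf_div divff ?mulr1 // invr_neq0 // lt0r_neq0.
Qed.

End ConditionalLaw.

(** * Real powers and the inverse root *)

Lemma powR_prod (R : realType) (I : finType) (P : pred I) (f : I -> R) (b : R) :
  (forall i, 0 <= f i) ->
  (\prod_(i | P i) f i) `^ b = \prod_(i | P i) (f i) `^ b.
Proof.
(* [K] carries nonnegativity through the induction, since [powRM] requires it. *)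
move=> f_ge0; pose K (x y : R) := 0 <= x /\ x `^ b = y.
suff [] : K (\prod_(i | P i) f i) (\prod_(i | P i) (f i) `^ b) by [].
apply: big_ind2 => [|x1 y1 x2 y2 [x1_ge0 <-] [x2_ge0 <-]|i _].
- by split; rewrite ?ler01 ?powR1.
- by split; rewrite ?mulr_ge0 ?powRM.
- by split.
Qed.

Lemma le_neg_root (R : realType) (beta p x : R) : 0 < beta -> 0 < p -> 0 <= x ->
  x * p `^ beta <= 1 -> (p%:E <= neg_root beta x)%E.
Proof.
move=> beta_gt0 p_gt0 x_ge0 le_xp; rewrite /neg_root.
case: eqP => [_|/eqP x_neq0]; first by rewrite leey.
have x_gt0 : 0 < x by rewrite lt_def x_neq0.
(* Both sides are turned into powers with exponent [beta^-1], which reduces the goal to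
   [p ^ beta <= x^-1]. *)
rewrite lee_fin powRN -(powRr1 (ltW p_gt0)) -(divff (lt0r_neq0 beta_gt0)) powRrM.
rewrite -[leRHS]powR_inv1 ?powR_ge0 // [leRHS]powRAC powR_inv1 //.
apply: ge0_ler_powR; rewrite ?nnegrE ?invr_ge0 ?powR_ge0 ?(ltW beta_gt0) //.
by rewrite -[leRHS]mulr1 ler_pdivlMl.
Qed.

(** * Chain rule and supermartingale property of the trials *)

Section TrialProbabilities.
Variables (R : realType) (n : nat) (C Z : 'I_n -> finType).
Variable mu : fdist R (traj C * traj Z)%type.

(* mu(C_i | Z_i, C_{<i}, Z_{<i}) at w *)
Definition trial_prob (i : 'I_n) (w : traj C * traj Z) : R :=
  Pr mu [pred v | agree i.+1 v.1 w.1 && agree i.+1 v.2 w.2] /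
  Pr mu [pred v | agree i v.1 w.1 && agree i.+1 v.2 w.2].

Lemma trial_prob_ge0 i w : 0 <= trial_prob i w.
Proof. by rewrite divr_ge0 ?Pr_ge0. Qed.

Lemma trial_prob_le1 i w : trial_prob i w <= 1.
Proof.
(* When the conditioning event is null, division by zero makes [trial_prob] equal to 0. *)
have [/eqP den0|den_neq0] := eqVneq (Pr mu
    [pred v | agree i v.1 w.1 && agree i.+1 v.2 w.2]) 0.
  by rewrite /trial_prob (eqP den0) invr0 mulr0 ler01.
rewrite ler_pdivrMr ?mul1r ?lt_def ?den_neq0 ?Pr_ge0 //.
by apply: Pr_le => v _ /=; rewrite !agreeS => /andP[/andP[-> _] ->].
Qed.

(** In the proof [A k / B k] is the probability of [C_{<k}] given [Z_{<k}]. By independence, also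
    revealing [Z_i] leaves that of [C_{<i}] unchanged, so each trial contributes exactly its
    [trial_prob]. *)
Lemma trial_prob_telescope w (mu_w : 0 < mu w) :
  (forall i : 'I_n, cond_indep mu (fun v => v.2 i) (fun v => past_of v.1 i)
                                  (fun v => past_of v.2 i)) ->
  cprob mu fst snd w = \prod_i trial_prob i w.
Proof.
move=> indep.
pose A k := Pr mu [pred v | agree k v.1 w.1 && agree k v.2 w.2].
pose B k := Pr mu [pred v | agree k v.2 w.2].
have agree_w k : agree k w.1 w.1 && agree k w.2 w.2 by apply/andP; split; apply/agreeP.
have B_neq0 k : B k != 0.
  by rewrite lt0r_neq0 // (Pr_gt0 (w := w)) //=; case/andP: (agree_w k).
suff AB k : (k <= n)%N -> A k / B k = \prod_(j < n | (j < k)%N) trial_prob j w.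
  rewrite (eq_bigl (fun j : 'I_n => (j < n)%N)) => [|j]; last by rewrite ltn_ord.
  rewrite -AB // /cprob /condPr; congr (_ / _); apply: eq_Pr => v /=;
  by rewrite !agree_all.
move: k; apply: ord_nat_ind => [|i IHi].
  rewrite big_pred0 // -(divff (B_neq0 0%N)); congr (_ / _).
  by apply: eq_Pr => v /=; rewrite agree0.
rewrite prod_ord_recr -IHi /trial_prob -/(A i.+1).
set D := Pr mu [pred v | agree i v.1 w.1 && agree i.+1 v.2 w.2].
have D_neq0 : D != 0.
  rewrite lt0r_neq0 // (Pr_gt0 (w := w)) //=.
  by case/andP: (agree_w i) => -> _; case/andP: (agree_w i.+1).
(* The independence hypothesis at the values taken by [w]; cancelling [B i] then gives
   [D / B i.+1 = A i / B i]. *)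
have eD : D / B i = B i.+1 / B i * (A i / B i).
  have pos : 0 < Pr mu [pred v | past_of v.2 i == past_of w.2 i].
    by rewrite (Pr_gt0 (w := w)) /=.
  refine (etrans (etrans _ (indep i _ pos (w.2 i) (past_of w.1 i))) _).
    rewrite /condPr; congr (_ / _); apply: eq_Pr => v /=.
      by rewrite !past_of_eq agreeS [agree i v.2 _ && _]andbC andbCA andbA.
    by rewrite past_of_eq.
  rewrite /condPr; congr (_ / _ * (_ / _)); apply: eq_Pr => v /=;
  by rewrite !past_of_eq ?agreeS // andbC.
have {}eD : D = B i.+1 * (A i / B i).
  by apply: (mulIf (invr_neq0 (B_neq0 i))); rewrite eD mulrAC.
rewrite mulrCA; congr (_ * _); apply: (mulIf D_neq0).
by rewrite divfK // eD mulKf.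
Qed.

Definition pasts (i : 'I_n) (w : traj C * traj Z) : past C i * past Z i :=
  (past_of w.1 i, past_of w.2 i).

(** This is the PEF inequality for the law of trial [i] given the past of [w0], multiplied by the
    probability of that past. *)
Lemma PEF_supermartingale (beta : R) (M : trial_models R C Z)
    (F : trial_factors R C Z) (i : 'I_n) (w0 : traj C * traj Z) :
  is_past_param_PEF beta M F -> std_model M mu ->
  \sum_(w | pasts i w == pasts i w0) mu w *
    (F i (past_of w.1 i) (past_of w.2 i) (w.1 i, w.2 i) * trial_prob i w `^ beta)
  <= \sum_(w | pasts i w == pasts i w0) mu w.
Proof.
move=> hF [model _].
pose c := past_of w0.1 i; pose z := past_of w0.2 i.
pose A := [pred w : traj C * traj Z | (past_of w.1 i == c) && (past_of w.2 i == z)].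
have hA w : (pasts i w == pasts i w0) = A w by rewrite /pasts xpair_eqE.
rewrite !(eq_bigl _ _ hA) -/(Pr mu A).
(* The model constrains only pasts of positive probability; on a null past both sides vanish. *)
have [pos|] := ltP 0 (Pr mu A); last first.
  move=> A_le0; rewrite big1 ?Pr_ge0 // => w Aw.
  have [mu_w|] := ltP 0 (mu w).
    by have := Pr_gt0 (A := A) Aw mu_w; rewrite ltNge A_le0.
  by move=> mu_w; have /eqP-> : mu w == 0; rewrite ?mul0r // eq_le mu_w fdist_ge0.
have := (hF i c z).2 _ (model i c z pos).
rewrite expect_cond_law ler_pdivrMr // mul1r.
apply: le_trans; rewrite le_eqVlt; apply/orP; left; apply/eqP.
apply: eq_bigr => w /andP[/eqP w_c /eqP w_z].
rewrite w_c w_z; congr (_ * (_ * _ `^ _)).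
(* Conditioning on the past and then on [Z_i] gives the same ratio as [trial_prob]. *)
rewrite /cprob condPr_cond_law /=; congr (_ / _); apply: eq_Pr => v /=.
  by rewrite !agreeS -w_c -w_z !past_of_eq andbACA andbC.
by rewrite !agreeS -w_c -w_z !past_of_eq andbA [RHS]andbC.
Qed.

End TrialProbabilities.

(** [trial_prob i] sees [w] only through its first [i.+1] trials, which precede trial [j]. *)
Lemma trial_prob_adapted (R : realType) (n : nat) (C Z : 'I_n -> finType)
    (mu : fdist R (traj C * traj Z)%type) (i j : 'I_n) w w' :
  (i < j)%N -> pasts j w = pasts j w' -> trial_prob mu i w = trial_prob mu i w'.
Proof.
move=> lt_ij [/eqP eqC /eqP eqZ]; rewrite past_of_eq in eqC.
rewrite past_of_eq in eqZ; rewrite /trial_prob.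
by congr (_ / _); apply: eq_Pr => v /=; congr (_ && _); apply: agree_right;
   apply: agree_sub eqC || apply: agree_sub eqZ; rewrite // ltnW.
Qed.

Theorem theorem23 (R : realType) (n : nat) (C Z : 'I_n -> finType)
  (beta : R) (hbeta : 0 < beta)
  (M : trial_models R C Z) (F : trial_factors R C Z)
  (hF : is_past_param_PEF beta M F)
  (eps : R) (heps0 : 0 < eps) (heps1 : eps <= 1) :
  is_UPE eps (std_model M) (U_est beta eps F) /\
  is_UPE eps (std_model M) (Ustar_est beta eps F).
Proof.
have scaled_T_ge0 k w : 0 <= Tprod F k w * eps.
  by rewrite mulr_ge0 ?(ltW heps0) //; apply: prodr_ge0 => j _; apply: (hF _ _ _).1.
(* Both estimators succeed wherever the bound holds for every [k]: the first uses it at [k = n], the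
   second at all [k]. *)
suff good mu (H : std_model M mu) (G : traj C * traj Z -> \bar R) :
    (forall w, 0 < mu w ->
       (forall k : 'I_n.+1, Tprod F k w * eps * cprob mu fst snd w `^ beta <= 1) ->
       ((cprob mu fst snd w)%:E <= G w)%E) ->
    1 - eps <= Pr mu [pred w | ((cprob mu fst snd w)%:E <= G w)%E].
  split=> mu H; apply: good => // w mu_w le1; apply: le_neg_root => //.
  - exact: cprob_gt0.
  - exact: (le1 ord_max).
  - exact: cprob_gt0.
  - by apply: le_trans (scaled_T_ge0 0%N w) _; apply: bigmax_ge_id.
  - rewrite -ler_pdivlMr ?powR_gt0 ?cprob_gt0 //; apply: bigmax_le => [|k _];
    by rewrite ler_pdivlMr ?powR_gt0 ?cprob_gt0 //; apply: (le1 ord0) || apply: le1.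
case: (H) => _ indep.
pose X i w := F i (past_of w.1 i) (past_of w.2 i) (w.1 i, w.2 i) *
  trial_prob mu i w `^ beta.
have X_ge0 i w : 0 <= X i w by rewrite mulr_ge0 ?powR_ge0 ?(hF _ _ _).1.
have X_adapted (i j : 'I_n) w w' :
    (i < j)%N -> pasts j w = pasts j w' -> X i w = X i w'.
  move=> lt_ij eq_h; case: (eq_h) => /eqP eqC /eqP eqZ.
  rewrite past_of_eq in eqC; rewrite past_of_eq in eqZ.
  rewrite /X (trial_prob_adapted mu lt_ij eq_h).
  have /eqP-> : past_of w.1 i == past_of w'.1 i.
    by rewrite past_of_eq (agree_sub (ltnW lt_ij)).
  have /eqP-> : past_of w.2 i == past_of w'.2 i.
    by rewrite past_of_eq (agree_sub (ltnW lt_ij)).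
  by rewrite (agreeP _ _ _ eqC i lt_ij) (agreeP _ _ _ eqZ i lt_ij).
(* With total mass 1, the threshold [eps^-1] bounds the crossing probability by [eps]. *)
have := Ville_inequality (h := @pasts n C Z) (fdist_ge0 mu) X_ge0 X_adapted
  (fun i w0 => PEF_supermartingale i w0 hF H) eps^-1.
rewrite fdist_sum1 ler_pdivrMl // mulr1 => Ville le_G.
rewrite Pr_predC lerD2l lerN2; apply: le_trans Ville; apply: Pr_le => w mu_w /=.
(* Failure of the estimator must force a crossing; contrapositively, no crossing yields the bound
   for every [k]. *)
apply: contraR; rewrite negb_exists => /forallP ncross; apply: le_G => // k.
have := ncross k; rewrite -leNgt -[X in _ <= X -> _]mul1r ler_pdivlMr //.
apply: le_trans; rewrite mulrAC ler_wpM2r ?(ltW heps0) // /X big_split /=.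
rewrite /Tprod ler_wpM2l //; first by apply: prodr_ge0 => j _; apply: (hF _ _ _).1.
rewrite -powR_prod => [|j]; last exact: trial_prob_ge0.
rewrite trial_prob_telescope //; apply: ge0_ler_powR; rewrite ?nnegrE ?(ltW hbeta) //.
- by apply: prodr_ge0 => j _; apply: trial_prob_ge0.
- by apply: prodr_ge0 => j _; apply: trial_prob_ge0.
- rewrite [leLHS](bigID (fun j : 'I_n => (j < k)%N)) /=.
  rewrite ler_piMr ?prodr_ge0 // => [j _|]; first exact: trial_prob_ge0.
  by apply: prodr_ile1 => j; rewrite trial_prob_ge0 trial_prob_le1.
Qed.
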